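(* Let $\mathcal{C}$ be a Cayley division algebra over an arbitrary field $\mathbb{F}$, with norm $\mathrm{n}$. Then any local derivation of $\mathcal{C}$ is a $2$-local derivation. As a consequence, the space of $2$-local derivations of $\mathcal{C}$ coincides with $\{d\in\mathfrak{so}(\mathcal{C},\mathrm{n})\mid d(1)=0\}\simeq\mathfrak{so}(\mathcal{C}_0,\mathrm{n})$.
   Context: A Cayley algebra over a field $\mathbb{F}$ is a unital (not necessarily associative) $\mathbb{F}$-algebra $\mathcal{C}$ of dimension $8$ endowed with a quadratic form $\mathrm{n}:\mathcal{C}\to\mathbb{F}$ (the norm) that is multiplicative, $\mathrm{n}(xy)=\mathrm{n}(x)\mathrm{n}(y)$ for all $x,y\in\mathcal{C}$, and nonsingular, i.e. its polar form $\mathrm{n}(x,y):=\mathrm{n}(x+y)-\mathrm{n}(x)-\mathrm{n}(y)$ is a nondegenerate bilinear form. A Cayley division algebra is a Cayley algebra whose norm is anisotropic ($\mathrm{n}(x)\neq 0$ for all $x\neq 0$). The trace is $t(x)=\mathrm{n}(x,1)$, and $\mathcal{C}_0$ denotes the subspace of trace $0$ elements. A derivation of $\mathcal{C}$ is a linear map $d:\mathcal{C}\to\mathcal{C}$ with $d(xy)=d(x)y+xd(y)$ for all $x,y$. A local derivation is a linear map $\Delta:\mathcal{C}\to\mathcal{C}$ such that for every $x\in\mathcal{C}$ there is a derivation $d_x$ with $\Delta(x)=d_x(x)$. A $2$-local derivation is a map $\Delta:\mathcal{C}\to\mathcal{C}$ (not assumed linear) such that for every pair $x,y\in\mathcal{C}$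 there is a derivation $d_{x,y}$ with $\Delta(x)=d_{x,y}(x)$ and $\Delta(y)=d_{x,y}(y)$. $\mathfrak{so}(\mathcal{C},\mathrm{n})=\{d\in\mathrm{End}_{\mathbb{F}}(\mathcal{C})\mid \mathrm{n}(x,d(x))=0\ \forall x\in\mathcal{C}\}$, with the commutator bracket. If the characteristic of $\mathbb{F}$ is not $2$, $\mathfrak{so}(\mathcal{C}_0,\mathrm{n})=\{d\in\mathrm{End}_{\mathbb{F}}(\mathcal{C}_0)\mid \mathrm{n}(v,d(v))=0\ \forall v\in\mathcal{C}_0\}$; if the characteristic is $2$, $\mathfrak{so}(\mathcal{C}_0,\mathrm{n})=\{d\in\mathrm{End}_{\mathbb{F}}(\mathcal{C}_0)\mid \mathrm{trace}(d)=0 \text{ and } \mathrm{n}(v,d(v))=0\ \forall v\in\mathcal{C}_0\}$. The isomorphism $\simeq$ in the claim is the restriction map $d\mapsto d|_{\mathcal{C}_0}$ (an isomorphism of Lie algebras in any characteristic). *)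

(* Defs.v *)
From HB Require Import structures.
From mathcomp Require Import all_boot all_order all_algebra.

Set Implicit Arguments.
Unset Strict Implicit.
Unset Printing Implicit Defensive.

Import GRing.Theory.
Local Open Scope ring_scope.

Definition polar_of (F : fieldType) (V : vectType F) (q : V -> F) (x y : V) : F :=
  q (x + y) - q x - q y.

Definition quadratic_form (F : fieldType) (V : vectType F) (q : V -> F) : Prop :=
  (forall (a : F) (x : V), q (a *: x) = a ^+ 2 * q x) /\
  bilinear_for *%R *%R (polar_of q).

(* The product is only bilinear and unital: MathComp's algebra structures are
   associative, hence this separate record. *)
Record cayleyAlg (F : fieldType) := CayleyAlg {
  cayley_carrier :> vectType F;
  cmul : {bilinear cayley_carrier -> cayley_carrier -> cayley_carrier};
  cone : cayley_carrier;
  cnorm : cayley_carrier -> F;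
  cmul1x : left_id cone cmul;
  cmulx1 : right_id cone cmul;
  cayley_dim : \dim {: cayley_carrier} = 8%N;
  cnorm_quadratic : quadratic_form cnorm;
  cnormM : forall x y, cnorm (cmul x y) = cnorm x * cnorm y;
  cnorm_nondegenerate :
    forall x, (forall y, polar_of cnorm x y = 0) -> x = 0
}.

Arguments cmul {F c}.
Arguments cone {F c}.
Arguments cnorm {F c}.

Definition cayley_division (F : fieldType) (C : cayleyAlg F) : Prop :=
  forall x : C, x != 0 -> cnorm x != 0.

Definition polar (F : fieldType) (C : cayleyAlg F) : C -> C -> F :=
  polar_of (@cnorm F C).

HB.instance Definition _ (F : fieldType) (C : cayleyAlg F) :=
  bilinear_isBilinear.Build F C C F *%R *%R (@polar F C)
    (proj2 (cnorm_quadratic C)).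

Definition ctrace (F : fieldType) (C : cayleyAlg F) (x : C) : F^o :=
  polar x cone.

Fact ctrace_is_linear (F : fieldType) (C : cayleyAlg F) : linear (@ctrace F C).
Proof. exact: (proj2 (cnorm_quadratic C)).1 cone. Qed.

HB.instance Definition _ (F : fieldType) (C : cayleyAlg F) :=
  GRing.isLinear.Build F C F^o _ (@ctrace F C) (@ctrace_is_linear F C).

Definition trace0 (F : fieldType) (C : cayleyAlg F) : {vspace C} :=
  lker (linfun (@ctrace F C)).

Lemma mem_trace0 (F : fieldType) (C : cayleyAlg F) (x : C) :
  (x \in trace0 C) = (ctrace x == 0).
Proof. by rewrite memv_ker lfunE. Qed.

Definition derivation (F : fieldType) (C : cayleyAlg F) (d : 'End(C)) : Prop :=
  forall x y : C, d (cmul x y) = cmul (d x) y + cmul x (d y).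

Definition local_derivation (F : fieldType) (C : cayleyAlg F) (D : 'End(C)) :
    Prop :=
  forall x : C, exists2 d : 'End(C), derivation d & D x = d x.

Definition two_local_derivation (F : fieldType) (C : cayleyAlg F)
    (D : C -> C) : Prop :=
  forall x y : C,
    exists d : 'End(C), [/\ derivation d, D x = d x & D y = d y].

Definition so (F : fieldType) (C : cayleyAlg F) (d : 'End(C)) : Prop :=
  forall x : C, polar x (d x) = 0.

Definition so_fix1 (F : fieldType) (C : cayleyAlg F) (d : 'End(C)) : Prop :=
  so d /\ d cone = 0.

Definition lfun_trace (F : fieldType) (V : vectType F) (d : 'End(V)) : F :=
  \sum_(i < \dim {: V}) coord (vbasis {: V}) i (d (vbasis {: V})`_i).

Definition so_trace0 (F : fieldType) (C : cayleyAlg F)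
    (d : 'End(subvs_of (trace0 C))) : Prop :=
  (2%N \in [pchar F] -> lfun_trace d = 0) /\
  forall v : subvs_of (trace0 C), polar (vsval v) (vsval (d v)) = 0.

(* Compression to the trace-zero subspace; it is the restriction of d as soon
   as d preserves that subspace. *)
Definition res_trace0 (F : fieldType) (C : cayleyAlg F) (d : 'End(C)) :
    'End(subvs_of (trace0 C)) :=
  (linfun (vsproj (trace0 C)) \o d \o linfun vsval)%VF.

Definition lie_bracket (F : fieldType) (V : vectType F) (d e : 'End(V)) :
    'End(V) :=
  (d \o e)%VF - (e \o d)%VF.

Definition lie_subalgebra (F : fieldType) (V : vectType F)
    (S : 'End(V) -> Prop) : Prop :=
  [/\ S 0,
      forall (a : F) (d e : 'End(V)), S d -> S e -> S (a *: d + e)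
    & forall d e : 'End(V), S d -> S e -> S (lie_bracket d e)].

Definition lie_isomorphism (F : fieldType) (V W : vectType F)
    (S : 'End(V) -> Prop) (T : 'End(W) -> Prop) (phi : 'End(V) -> 'End(W)) :
    Prop :=
  [/\ lie_subalgebra S /\ lie_subalgebra T,
      forall (a : F) (d e : 'End(V)), S d -> S e ->
        phi (a *: d + e) = a *: phi d + phi e,
      forall d e : 'End(V), S d -> S e ->
        phi (lie_bracket d e) = lie_bracket (phi d) (phi e),
      forall d e : 'End(V), S d -> S e -> phi d = phi e -> d = e
    & (forall d : 'End(V), S d -> T (phi d)) /\
      (forall f : 'End(W), T f -> exists2 d : 'End(V), S d & phi d = f)].

(* Main.v *)
Require Import Defs.
From HB Require Import structures.
From mathcomp Require Import all_boot all_order all_algebra.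
From mathcomp Require Import ring zify.

Import GRing.Theory.
Local Open Scope ring_scope.

(** The argument rests on one explicit family of derivations, available in
    every characteristic. Write [n(x, y)] for the polar form and, for [a] and
    [b] of trace zero, [s_ab] for the skew map [x |-> n(a, x) b - n(b, x) a].
    The middle Moufang identity gives an infinitesimal triality relation
    ([skew_map_triality])
      [s_ab(zw) - n(a, b) zw = (a(bz))w + z((wb)a)].
    Summing it over pairs of trace zero elements with [\sum_i a_i b_i = 0]
    makes the correction terms [n(a_i, b_i)] cancel, so that the sum of the
    [s_(a_i b_i)] is a derivation ([skew_sum_derivation]).

    Let [U] be a subspace of dimension at most 3 that contains 1, and [W] its
    orthogonal. In a division algebra the products of two elements of [W] span
    everything ([mem_cmul_span]): if [z] is orthogonal to all of them, then
    [zW] lies in the orthogonal [U] of [W], whereas [W] has dimension at least 5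
    and left multiplication by a nonzero [z] is injective. Hence every [s_ab]
    can be corrected, by maps [s_cd] with [c, d] in [W], which vanish on [U],
    into a derivation that agrees with [s_ab] on [U] ([skew_map_agrees]).

    A map [D] in [so(C, n)] that kills 1 agrees on the span of [1, x, y] with a
    sum of two maps [s_ab], obtained by moving first [x] and then [y] as [D]
    does ([so_fix1_peel]). So on that span it agrees with a derivation
    ([so_fix1_agrees]): every such [D] is a 2-local derivation. Conversely,
    derivations are skew and kill 1, by the quadratic equation of [C]; a local
    derivation inherits this at once, and so does a 2-local one, since skewness
    involves two vectors only and forces linearity.

    For the restriction to the trace zero subspace [C_0], the only delicate
    point is characteristic 2, where 1 belongs to [C_0]. There a skew map [D] of
    [C] with [D(1) = l 1] restricts to a map of [C_0] of trace [l]
    ([lfun_trace_restriction]); the trace condition that defines [so(C_0, n)] is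
    thus exactly the condition [D(1) = 0]. *)

(** * Linear maps, alternating sums and traces *)

(* Closes [L = R] when [L - R] and [A - B] agree as ring expressions, for
   [e : A = B]. *)
Ltac ring_from e :=
  apply/eqP; rewrite -subr_eq0;
  match type of e with ?A = ?B =>
    match goal with |- is_true (?L == 0) =>
      have -> : L = A - B; [by ring | by rewrite e subrr]
    end
  end.

Lemma lfun_of_linear {F : fieldType} {V W : vectType F} (f : V -> W) :
  linear f -> exists g : 'Hom(V, W), g =1 f.
Proof.
move=> f_lin; pose g : {linear V -> W} :=
  HB.pack f (GRing.isLinear.Build _ _ _ _ f f_lin).
by exists (linfun g) => x; rewrite lfunE.
Qed.

Lemma sum_alternating {R : zmodType} m (M : 'I_m -> 'I_m -> R) :
  (forall i, M i i = 0) -> (forall i j, M i j = - M j i) ->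
  \sum_i \sum_j M i j = 0.
Proof.
move=> M0 Malt.
have split_row i : \sum_j M i j =
    \sum_(j < m | (j < i)%N) M i j + \sum_(j < m | (i < j)%N) M i j.
  rewrite (bigID (fun j : 'I_m => (j < i)%N)) /=; congr (_ + _).
  rewrite (bigD1 i) ?ltnn //= M0 add0r; apply: eq_bigl => j.
  by rewrite -leqNgt ltn_neqAle andbC eq_sym.
under eq_bigr do rewrite split_row.
rewrite big_split /= [X in _ + X](exchange_big_dep predT) //= -big_split /=.
rewrite big1 // => i _; rewrite -big_split big1 //= => j _.
by rewrite [M j i]Malt subrr.
Qed.

Lemma lfun_trace_comp {F : fieldType} {V : vectType F} (d e : 'End(V)) :
  lfun_trace (d \o e)%VF =
  \sum_(i < \dim {: V}) \sum_(j < \dim {: V})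
    coord (vbasis {:V}) j (e (vbasis {:V})`_i) *
    coord (vbasis {:V}) i (d (vbasis {:V})`_j).
Proof.
apply: eq_bigr => i _; rewrite comp_lfunE.
rewrite [X in d X](coord_vbasis (memvf _)) linear_sum linear_sum /=.
by apply: eq_bigr => j _; rewrite !linearZ.
Qed.

Lemma lfun_trace_linear {F : fieldType} {V : vectType F} (k : F)
    (d e : 'End(V)) :
  lfun_trace (k *: d + e) = k * lfun_trace d + lfun_trace e.
Proof.
rewrite /lfun_trace mulr_sumr -big_split /=; apply: eq_bigr => i _.
by rewrite add_lfunE scale_lfunE linearD linearZ.
Qed.

Lemma lfun_trace_bracket {F : fieldType} {V : vectType F} (d e : 'End(V)) :
  lfun_trace (lie_bracket d e) = 0.
Proof.
rewrite /lie_bracket addrC -scaleN1r lfun_trace_linear !lfun_trace_comp.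
rewrite exchange_big mulN1r addrC; apply/eqP; rewrite subr_eq0; apply/eqP.
by apply: eq_bigr => i _; apply: eq_bigr => j _; rewrite mulrC.
Qed.

Lemma lie_bracketE {F : fieldType} {V : vectType F} (d e : 'End(V)) x :
  lie_bracket d e x = d (e x) - e (d x).
Proof. by rewrite add_lfunE opp_lfunE !comp_lfunE. Qed.

Section CayleyAlgebra.

Context {F : fieldType} {C : cayleyAlg F}.
Implicit Types (x y z w a b : C) (U : {vspace C}).

Notation "x ** y" := (cmul x y) (at level 40, left associativity).
Notation one := (@cone F C).
Notation n := (@cnorm F C).

(** * Identities of composition algebras *)

(** The canonical conjugation [x |-> t(x) 1 - x]. *)
Definition cconj x : C := polar x one *: one - x.

Lemma polarDl x y z : polar (x + y) z = polar x z + polar y z.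
Proof. exact: linearDl. Qed.

Lemma polarDr x y z : polar x (y + z) = polar x y + polar x z.
Proof. exact: linearDr. Qed.

Lemma polarNl x z : polar (- x) z = - polar x z.
Proof. exact: linearNl. Qed.

Lemma polarNr x z : polar x (- z) = - polar x z.
Proof. exact: linearNr. Qed.

Lemma polarZl (k : F) x z : polar (k *: x) z = k * polar x z.
Proof. exact: linearZl_LR. Qed.

Lemma polarZr (k : F) x z : polar x (k *: z) = k * polar x z.
Proof. exact: linearZr_LR. Qed.

Lemma polar0l z : polar (0 : C) z = 0.
Proof. exact: linear0l. Qed.

Definition polarE := (polarDl, polarDr, polarNl, polarNr, polarZl, polarZr).

Definition cmulE :=
  (@linearDl _ _ _ _ _ _ (@cmul F C), @linearDr _ _ _ _ _ _ (@cmul F C),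
   @linearNl _ _ _ _ _ _ (@cmul F C), @linearNr _ _ _ _ _ _ (@cmul F C),
   @linearZl_LR _ _ _ _ _ _ (@cmul F C), @linearZr_LR _ _ _ _ _ _ (@cmul F C)).

Lemma polarC x y : polar x y = polar y x.
Proof. by rewrite /polar /polar_of [x + y]addrC addrAC. Qed.

Lemma cnormD x y : n (x + y) = n x + n y + polar x y.
Proof. by rewrite /polar /polar_of; ring. Qed.

Lemma cnorm0 : n 0 = 0.
Proof.
by rewrite -[0](scale0r (0 : C)) (proj1 (cnorm_quadratic C)) expr0n mul0r.
Qed.

Lemma polarxx x : polar x x = n x *+ 2.
Proof.
have [nZ _] := cnorm_quadratic C.
rewrite /polar /polar_of -[x]scale1r -scalerDl !nZ; ring.
Qed.

Lemma polar_ext x y : (forall z, polar x z = polar y z) -> x = y.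
Proof.
move=> exy; apply/eqP; rewrite -subr_eq0; apply/eqP.
apply: cnorm_nondegenerate => z; change (polar (x - y) z = 0).
by rewrite !polarE exy subrr.
Qed.

Lemma polar_mull x y z : polar (x ** y) (x ** z) = n x * polar y z.
Proof. by rewrite /polar /polar_of -linearDr !cnormM; ring. Qed.

Lemma polar_mul_mul x y z w :
  polar (x ** y) (z ** w) + polar (x ** w) (z ** y) = polar x z * polar y w.
Proof.
have := polar_mull (x + z) y w.
rewrite !cmulE !polarE cnormD !polar_mull [polar (z ** y) _]polarC.
by move=> e; ring_from e.
Qed.

Lemma cone_neq0 : one != 0.
Proof.
apply/eqP => one0; have := cayley_dim C.
suff -> : {:C}%VS = 0%VS by rewrite dimv0.
apply/eqP; rewrite -subv0; apply/subvP => x _.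
by rewrite memv0 -[x]cmul1x one0 linear0l.
Qed.

Lemma cnorm1 : n one = 1.
Proof.
have n11 : n one * n one = n one by rewrite -cnormM cmul1x.
have [n0|/mulfI nI] := eqVneq (n one) 0; last by apply: nI; rewrite n11 mulr1.
case/eqP: cone_neq0; apply: cnorm_nondegenerate => y.
have nz z : n z = 0 by rewrite -[z]cmul1x cnormM n0 mul0r.
by rewrite /polar_of !nz; ring.
Qed.

Lemma cconjE x z : polar (cconj x) z = polar x one * polar one z - polar x z.
Proof. by rewrite !polarE. Qed.

Lemma cconjK x : cconj (cconj x) = x.
Proof. apply: polar_ext => z; rewrite !cconjE polarxx cnorm1; ring. Qed.

Lemma polar_cconj x y : polar (cconj x) (cconj y) = polar x y.
Proof.
rewrite cconjE ![polar _ (cconj y)]polarC !cconjE polarxx cnorm1.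
by rewrite ![polar y _]polarC [polar one x]polarC; ring.
Qed.

Lemma polar_conjr x y :
  polar x (cconj y) = polar x one * polar y one - polar x y.
Proof.
by rewrite polarC cconjE [polar one _]polarC [polar y x]polarC mulrC.
Qed.

Lemma polar_mull_adj x y z : polar (x ** y) z = polar y (cconj x ** z).
Proof.
rewrite [RHS]polarC !cmulE cmul1x !polarE.
have := polar_mul_mul x y one z; rewrite !cmul1x [polar y z]polarC => <-.
by ring.
Qed.

Lemma polar_mulr_adj x y z : polar (x ** y) z = polar x (z ** cconj y).
Proof.
rewrite [RHS]polarC !cmulE cmulx1 !polarE /=.
have := polar_mul_mul x y z one; rewrite !cmulx1 => e.
by rewrite [polar z x]polarC [_ * polar x z]mulrC -e [polar x _]polarC; ring.
Qed.

Lemma cconjM x y : cconj (x ** y) = cconj y ** cconj x.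
Proof.
apply: polar_ext => z.
rewrite -[z in LHS]cconjK polar_cconj polar_mull_adj polarC polar_mulr_adj.
by rewrite cconjK polarC polar_mull_adj polarC.
Qed.

Lemma cmul_conjK x y : cconj x ** (x ** y) = n x *: y.
Proof.
apply: polar_ext => z.
by rewrite polar_mull_adj cconjK polar_mull polarZl.
Qed.

Lemma cnorm_conj x : n (cconj x) = n x.
Proof.
have [nZ _] := cnorm_quadratic C.
have := cnormD (cconj x) x; rewrite subrK nZ cnorm1 cconjE polarxx.
rewrite [polar one x]polarC => e.
by ring_from (esym e).
Qed.

Lemma cmul_conjVK x y : x ** (cconj x ** y) = n x *: y.
Proof. by rewrite -{1}[x]cconjK cmul_conjK cnorm_conj. Qed.

(** The middle Moufang identity [(ax)(ya) = a(xy)a], with its right-hand side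
    in a form that is quadratic in [a] and linear in the conjugate of [xy]. *)
Lemma middle_moufang a x y :
  (a ** x) ** (y ** a) = polar a (cconj (x ** y)) *: a - n a *: cconj (x ** y).
Proof.
apply: polar_ext => z.
rewrite !polarE polar_mulr_adj (cconjM y a).
have := polar_mul_mul a x z (cconj a ** cconj y).
rewrite cmul_conjVK polarZl => e.
have ea : polar x (cconj a ** cconj y) = polar a (cconj (x ** y)).
  rewrite -[polar a _]polar_cconj cconjK.
  by rewrite [RHS]polarC polar_mulr_adj.
have ez : polar (cconj y) (z ** x) = polar (cconj (x ** y)) z.
  by rewrite cconjM polar_mulr_adj cconjK.
rewrite ea ez polar_conjr cconjE in e.
by ring_from e.
Qed.

Lemma middle_moufangD a b x y :
  (a ** x) ** (y ** b) + (b ** x) ** (y ** a) =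
  polar a (cconj (x ** y)) *: b + polar b (cconj (x ** y)) *: a
  - polar a b *: cconj (x ** y).
Proof.
have e := middle_moufang (a + b) x y.
rewrite !cmulE !middle_moufang cnormD in e.
apply: polar_ext => z; have := congr1 (fun t => polar t z) e.
by rewrite /= !polarE => {}e; ring_from e.
Qed.

Lemma cmul_symm x y :
  x ** y + y ** x = polar x one *: y + polar y one *: x - polar x y *: one.
Proof.
have e := middle_moufangD x one y one.
rewrite !cmul1x !cmulx1 in e; rewrite e; apply: polar_ext => z.
rewrite !polarE ?cconjE ?polar_conjr polarxx cnorm1.
by rewrite [polar one y]polarC; ring.
Qed.

(** Triality for left and right multiplications by a trace zero element: their
    sum is the skew map of the pair [(1, a)]. *)
Lemma cmul_infinitesimal a x y : polar a one = 0 ->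
  (a ** x) ** y + x ** (y ** a) =
  polar (x ** y) one *: a - polar a (x ** y) *: one.
Proof.
move=> a0; have := middle_moufangD a one x y.
rewrite !cmul1x !cmulx1 => ->; apply: polar_ext => z.
rewrite !polarE ?polar_conjr polarxx cnorm1 a0.
by rewrite [polar one (x ** y)]polarC; ring.
Qed.

(** The element of [so(C, n)] attached to the bivector [a /\ b]. *)
Definition skew_map a b x : C := polar a x *: b - polar b x *: a.

(** Infinitesimal triality for skew maps of trace zero elements. The elements
    [a] and [b] need not be orthogonal: the term [polar a b] accounts for the
    general case, which makes both sides bilinear in [a] and [b]. *)
Lemma skew_map_triality a b z w :
  polar a one = 0 -> polar b one = 0 ->
  skew_map a b (z ** w) - polar a b *: (z ** w) =
  (a ** (b ** z)) ** w + z ** ((w ** b) ** a).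
Proof.
move=> a0 b0; set p := z ** w.
have e1 := cmul_infinitesimal a (b ** z) w a0.
have e2 := cmul_infinitesimal a z (w ** b) a0.
have e3 := cmul_infinitesimal b z w b0.
have e4 := middle_moufangD a b z w.
(* [e1 + e2 - e4] is the claim, up to the values of [e3] paired with [one] and
   with [a]. *)
apply: polar_ext => u.
have t1 := congr1 (fun t => polar t one) e3.
have ta := congr1 (polar a) e3.
rewrite /= !polarE ?a0 ?b0 ?polarxx ?cnorm1 in t1 ta.
have f1 := congr1 (fun t => polar t u) e1.
have f2 := congr1 (fun t => polar t u) e2.
have f4 := congr1 (fun t => polar t u) e4.
rewrite /= !polarE ?polar_conjr ?cconjE ?a0 ?b0 in f1 f2 f4 t1 ta *.
rewrite (canRL (addrK _) f1) (canRL (addKr _) f2) (canRL (addKr _) f4).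
by rewrite (canRL (addrK _) t1) (canRL (addrK _) ta) /p; ring.
Qed.

(** * Duality and a family of derivations *)

Lemma polar_sumr (I : Type) (r : seq I) (P : pred I) (E : I -> C) x :
  polar x (\sum_(i <- r | P i) E i) = \sum_(i <- r | P i) polar x (E i).
Proof. exact: linear_sumr. Qed.

Lemma polar_suml (I : Type) (r : seq I) (P : pred I) (E : I -> C) x :
  polar (\sum_(i <- r | P i) E i) x = \sum_(i <- r | P i) polar (E i) x.
Proof. exact: linear_sumlz. Qed.

Fact polar_row_is_linear m (X : m.-tuple C) :
  linear (fun x => \row_i polar x (tnth X i) : 'rV[F]_m).
Proof. by move=> k x y; apply/rowP => i; rewrite !mxE !polarE. Qed.

(** The linear map that lists the pairings with a family of vectors. *)
Definition polar_row m (X : m.-tuple C) : 'Hom(C, 'rV[F]_m) :=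
  linfun (HB.pack (fun x => \row_i polar x (tnth X i) : 'rV[F]_m)
    (GRing.isLinear.Build _ _ _ _ _ (polar_row_is_linear m X))
   : {linear C -> 'rV[F]_m}).

Lemma polar_rowE m (X : m.-tuple C) x i :
  polar_row m X x 0 i = polar x (tnth X i).
Proof. by rewrite lfunE /= mxE. Qed.

(** Every linear form is represented by a vector, as the polar form is
    nondegenerate. *)
Lemma polar_functional (f : C -> F^o) :
  linear f -> exists a, forall z, polar a z = f z.
Proof.
move=> /lfun_of_linear[g fE]; suff [a aE] : exists a, forall z, polar a z = g z.
  by exists a => z; rewrite aE fE.
pose X := vbasis {:C}.
have kerX : lker (polar_row _ X) == 0%VS.
  rewrite -subv0; apply/subvP => x; rewrite memv_ker memv0 => /eqP x0.
  apply/eqP/polar_ext => z; rewrite (coord_vbasis (memvf z)).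
  rewrite !polar_sumr; apply: eq_bigr => i _; rewrite !polarE; congr (_ * _).
  have := congr1 (fun v : 'rV_ _ => v 0 i) x0.
  by rewrite polar_rowE mxE (tnth_nth 0) => ->; rewrite polar0l.
have: \row_i g (tnth X i) \in limg (polar_row _ X).
  suff -> : limg (polar_row _ X) = fullv by apply: memvf.
  apply/eqP; rewrite eqEdim subvf /= limg_dim_eq; last first.
    by rewrite capfv; apply/eqP.
  by rewrite [\dim {:'rV_ _}]dimvf /dim /= mul1n.
case/memv_imgP => a _ fa; exists a => z.
rewrite (coord_vbasis (memvf z)) polar_sumr linear_sum /=.
apply: eq_bigr => i _; rewrite polarE linearZ /=; congr (_ * _).
have := congr1 (fun v : 'rV_ _ => v 0 i) fa.
by rewrite polar_rowE mxE (tnth_nth 0) => ->.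
Qed.

Lemma polar_separate U x :
  x \notin U -> exists2 a, forall u, u \in U -> polar a u = 0 & polar a x = 1.
Proof.
move=> xU; pose X := [tuple of x :: vbasis U].
have freeX : free X.
  by rewrite /= free_cons (span_basis (vbasisP U)) xU (basis_free (vbasisP U)).
have [a aE] := polar_functional _ (linearP (coord X ord0)).
exists a => [u /coord_vbasis->|]; rewrite aE.
  rewrite linear_sum big1 // => i _; rewrite linearZ /=.
  have := coord_free (lift ord0 i) ord0 freeX.
  by rewrite /= => ->; rewrite mulr0.
by have := coord_free ord0 ord0 freeX; rewrite /= => ->.
Qed.

(** The orthogonal for the polar form, which need not be a complement. *)
Definition orth U : {vspace C} := lker (polar_row _ (vbasis U)).

Lemma orthP U x : reflect (forall u, u \in U -> polar x u = 0) (x \in orth U).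
Proof.
rewrite memv_ker; apply: (iffP eqP) => [x0 u /coord_vbasis->|x0].
  rewrite polar_sumr big1 // => i _; rewrite polarE -tnth_nth.
  have := congr1 (fun v : 'rV_ _ => v 0 i) x0.
  by rewrite polar_rowE mxE => ->; rewrite mulr0.
apply/rowP => i; rewrite polar_rowE mxE x0 //.
by apply: vbasis_mem; apply: mem_tnth.
Qed.

Lemma dim_orth U : (8 <= \dim U + \dim (orth U))%N.
Proof.
have := limg_ker_dim (polar_row _ (vbasis U)) fullv.
rewrite capfv cayley_dim => <-; rewrite addnC leq_add2r.
apply: leq_trans (dimvS (subvf _)) _.
by rewrite dimvf /dim /= mul1n.
Qed.

Lemma orth_orth U x : (forall w, w \in orth U -> polar x w = 0) -> x \in U.
Proof.
move=> xW; apply: contraT => /polar_separate [a aU ax].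
have /xW : a \in orth U by apply/orthP.
by rewrite polarC ax => /eqP; rewrite oner_eq0.
Qed.

Lemma cmul_injl : cayley_division C -> forall a, a != 0 -> injective (cmul a).
Proof.
move=> Cdiv a a0 x y axy; apply/eqP; rewrite -subr_eq0; apply: contraT => /Cdiv.
suff -> : n (x - y) = 0 by rewrite eqxx.
have /eqP : n (a ** (x - y)) = 0.
  by rewrite linearBr /= axy subrr cnorm0.
by rewrite cnormM mulf_eq0 (negPf (Cdiv a a0)) => /eqP.
Qed.

Lemma cmulr_sum (I : Type) (r : seq I) (P : pred I) (E : I -> C) x :
  x ** (\sum_(i <- r | P i) E i) = \sum_(i <- r | P i) x ** E i.
Proof. exact: linear_sumr. Qed.

Lemma cmull_sum (I : Type) (r : seq I) (P : pred I) (E : I -> C) x :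
  (\sum_(i <- r | P i) E i) ** x = \sum_(i <- r | P i) E i ** x.
Proof. exact: linear_sumlz. Qed.

(** Every element is a sum of products of two elements orthogonal to [U]. *)
Lemma mem_cmul_span (Cdiv : cayley_division C) U :
  one \in U -> (\dim U <= 3)%N ->
  forall p, exists2 s : seq (C * C),
    all (fun q => (q.1 \in orth U) && (q.2 \in orth U)) s
    & p = \sum_(q <- s) q.1 ** q.2.
Proof.
move=> U1 dimU p; pose good p := exists2 s : seq (C * C),
  all (fun q => (q.1 \in orth U) && (q.2 \in orth U)) s
  & p = \sum_(q <- s) q.1 ** q.2.
rewrite -/(good p).
set B := vbasis (orth U).
pose X := [seq c ** d | c <- B, d <- B].
have good0 : good 0 by exists [::]; rewrite ?big_nil.
have goodD x y : good x -> good y -> good (x + y).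
  move=> [s sW ->] [t tW ->]; exists (s ++ t); first by rewrite all_cat sW.
  by rewrite big_cat.
have goodX k x : x \in X -> good (k *: x).
  case/allpairsP => -[c d] [/vbasis_mem cW /vbasis_mem dW ->].
  exists [:: (k *: c, d)]; first by rewrite /= memvZ ?dW.
  by rewrite big_seq1 /= linearZl_LR.
suff /(@coord_span _ _ _ (in_tuple X)) -> : p \in <<X>>%VS.
  apply: (big_ind good) => // i _; apply: goodX.
  exact: mem_nth (ltn_ord i).
apply: contraT => /polar_separate [z zX zp].
have z0 : z != 0.
  by apply/eqP => z0; move/eqP: zp; rewrite z0 polar0l eq_sym oner_eq0.
have zBB c d : c \in orth U -> d \in orth U -> polar z (c ** d) = 0.
  move=> /coord_vbasis-> /coord_vbasis->.
  rewrite cmull_sum polar_sumr big1 // => i _.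
  rewrite cmulr_sum polar_sumr big1 // => j _.
  rewrite !cmulE !polarE zX ?mulr0 //; apply: memv_span.
  by apply: allpairs_f; apply: mem_nth; rewrite size_tuple.
(* [U] is the orthogonal of [orth U], so left multiplication by [z] maps
   [orth U] into [U], which is impossible for dimension reasons. Elements [d] of
   [orth U] have trace zero, so that their conjugate is [- d]. *)
have zW d : d \in orth U -> z ** d \in U.
  move=> dW; have d0 : cconj d = - d.
    by rewrite /cconj (orthP _ _ dW) // scale0r sub0r.
  apply: orth_orth => c cW; have := zBB _ _ cW dW.
  rewrite polarC polar_mulr_adj d0 polarC !cmulE !polarE => /eqP.
  by rewrite oppr_eq0 => /eqP.
have : (\dim (linfun (cmul z) @: orth U) <= \dim U)%N.
  by apply/dimvS/subvP => _ /memv_imgP[d /zW dU ->]; rewrite lfunE.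
have z_inj : lker (linfun (cmul z)) == 0%VS.
  by apply/lker0P => x y; rewrite !lfunE; apply: cmul_injl.
rewrite limg_dim_eq ?(eqP z_inj) ?capv0 //.
have := dim_orth U; lia.
Qed.

(** The sum of the skew maps of a list of pairs. *)
Definition skew_sum (s : seq (C * C)) x : C := \sum_(q <- s) skew_map q.1 q.2 x.

(** The condition [\sum_i a_i b_i = 0] also yields [\sum_i n(a_i, b_i) = 0], by
    taking traces, and then [\sum_i b_i a_i = 0]. *)
Lemma skew_sum_derivation (s : seq (C * C)) :
  all (fun q => (polar q.1 one == 0) && (polar q.2 one == 0)) s ->
  \sum_(q <- s) q.1 ** q.2 = 0 ->
  forall x y, skew_sum s (x ** y) = skew_sum s x ** y + x ** skew_sum s y.
Proof.
move=> /allP s0 prod0.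
have polar_sum0 : \sum_(q <- s) polar q.1 q.2 = 0.
  apply/eqP; rewrite -oppr_eq0 -sumrN; apply/eqP.
  have := congr1 (fun t => polar one t) prod0.
  rewrite [RHS]polarC polar0l polar_sumr => e; rewrite -[RHS]e.
  apply: eq_big_seq => q /s0/andP[/eqP a0 _].
  by rewrite [RHS]polarC polar_mulr_adj cmul1x polar_conjr a0 mul0r sub0r.
have prod0' : \sum_(q <- s) q.2 ** q.1 = 0.
  rewrite -[LHS]add0r -[X in X + _]prod0 -big_split /= -[RHS]oppr0.
  rewrite -[X in - X](scale0r one) -[X in X *: _]polar_sum0 scaler_suml -sumrN.
  apply: eq_big_seq => q /s0/andP[/eqP a0 /eqP b0].
  by rewrite cmul_symm a0 b0 !scale0r add0r sub0r.
have key x y : skew_sum s (x ** y) =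
    (\sum_(q <- s) q.1 ** (q.2 ** x)) ** y
    + x ** (\sum_(q <- s) (y ** q.2) ** q.1).
  rewrite cmull_sum cmulr_sum -big_split /=.
  rewrite -[LHS]subr0 -[X in _ - X](scale0r (x ** y)).
  rewrite -[X in X *: _]polar_sum0 scaler_suml.
  rewrite -sumrB; apply: eq_big_seq => q /s0/andP[/eqP a0 /eqP b0].
  exact: skew_map_triality.
have keyl x : skew_sum s x = \sum_(q <- s) q.1 ** (q.2 ** x).
  rewrite -[x in LHS]cmulx1 key cmulx1.
  under [X in _ ** X]eq_bigr do rewrite cmul1x.
  by rewrite prod0' linear0r addr0.
have keyr x : skew_sum s x = \sum_(q <- s) (x ** q.2) ** q.1.
  rewrite -[x in LHS]cmul1x key cmul1x.
  by under [X in X ** _]eq_bigr do rewrite cmulx1; rewrite prod0 linear0l add0r.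
by move=> x y; rewrite key -keyl -keyr.
Qed.

(** * Derivations and skew maps on a span of three vectors *)

Implicit Types (d D : 'End(C)).

Lemma so_skew d x y : so d -> polar (d x) y = - polar x (d y).
Proof.
move=> dso; have := dso (x + y); rewrite linearD /= !polarE !dso add0r addr0.
by move/eqP; rewrite addrC addr_eq0 polarC => /eqP.
Qed.

Lemma so_skewr d x y : so d -> polar x (d y) = - polar (d x) y.
Proof. by move=> /so_skew->; rewrite opprK. Qed.

Lemma cmul_sqr x : x ** x = polar x one *: x - n x *: one.
Proof.
have := middle_moufang x one one; rewrite !cmul1x !cmulx1 => ->.
apply: polar_ext => z.
by rewrite !polarE ?polar_conjr ?cconjE polarxx cnorm1; ring.
Qed.

(** If [d(x)] has nonzero trace, then applying [d] to the quadratic equation of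
    [x] shows that [x] is a scalar, which [d] kills. *)
Lemma derivation_so_fix1 d : derivation d -> so_fix1 d.
Proof.
move=> der; have d1 : d one = 0.
  have /eqP := der one one; rewrite !cmul1x cmulx1 -subr_eq0 opprD addNKr.
  by rewrite oppr_eq0 => /eqP.
have dZ k z : d (k *: z) = k *: d z by apply: linearZ.
split=> // x; have := der x x.
rewrite cmul_symm cmul_sqr linearB /= !dZ d1 scaler0 subr0.
rewrite [_ + polar x one *: _]addrC -addrA -[LHS]addr0 => /addrI/esym/eqP.
rewrite [polar x _]polarC subr_eq0 => /eqP e.
have [t0|t0] := eqVneq (polar (d x) one) 0.
  move/eqP: e; rewrite t0 scale0r eq_sym scaler_eq0 (negPf cone_neq0) orbF.
  by move/eqP.
have -> : d x = 0.
  rewrite -[x](scalerK t0) e !linearZ /= d1 !scaler0 //.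
by rewrite polar0l.
Qed.

Lemma derivationD d1 d2 :
  derivation d1 -> derivation d2 -> derivation (d1 + d2).
Proof.
by move=> der1 der2 x y; rewrite !lfunE /= der1 der2 !cmulE addrACA.
Qed.

Lemma skew_map_linear a b : linear (skew_map a b).
Proof.
move=> k x y; rewrite /skew_map; apply: polar_ext => z; rewrite !polarE; ring.
Qed.

Lemma skew_map_lfun a b : polar a one = 0 -> polar b one = 0 ->
  exists2 E : 'End(C), so_fix1 E & E =1 skew_map a b.
Proof.
move=> a0 b0; have [E EE] := lfun_of_linear _ (skew_map_linear a b).
exists E => //; split=> [x|]; rewrite EE /skew_map; last first.
  by rewrite a0 b0 !scale0r subr0.
by rewrite !polarE [polar x b]polarC [polar x a]polarC; ring.
Qed.

(** On a small subspace, a skew map of trace zero elements cannot be told apart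
    from a derivation. *)
Lemma skew_map_agrees (Cdiv : cayley_division C) U a b :
  one \in U -> (\dim U <= 3)%N -> polar a one = 0 -> polar b one = 0 ->
  exists2 d : 'End(C), derivation d & {in U, d =1 skew_map a b}.
Proof.
move=> U1 dimU a0 b0.
(* The pairs of [s] are orthogonal to [U], so their skew maps vanish on [U]. *)
have [s sW sE] := mem_cmul_span Cdiv _ U1 dimU (- (a ** b)).
have sum_lin : linear (skew_sum ((a, b) :: s)).
  move=> k x y; rewrite /skew_sum scaler_sumr -big_split /=.
  by apply: eq_bigr => q _; apply: skew_map_linear.
have [d dE] := lfun_of_linear _ sum_lin.
exists d => [x y|u uU]; rewrite !dE.
  apply: skew_sum_derivation; last by rewrite big_cons -sE subrr.
  rewrite /= a0 b0 eqxx /=; apply: sub_all sW => q /andP[/orthP-> //].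
  by move/orthP->; rewrite ?eqxx.
rewrite /skew_sum big_cons big1_seq ?addr0 // => q /andP[_ /(allP sW)].
by case/andP=> /orthP q1 /orthP q2; rewrite /skew_map q1 ?q2 // !scale0r subr0.
Qed.

(** A map of [so(C, n)] that kills a subspace containing 1 acts as a single skew
    map on the span of that subspace and one more vector. *)
Lemma so_fix1_peel D U y :
  so_fix1 D -> one \in U -> {in U, forall u, D u = 0} ->
  exists a b, [/\ polar a one = 0, polar b one = 0
    & {in (U + <[y]>)%VS, D =1 skew_map a b}].
Proof.
move=> [Dso D1] U1 DU.
have [yU|/polar_separate[a aU ay]] := boolP (y \in U).
  exists 0, 0; rewrite !polar0l; split=> // u.
  rewrite (addv_idPl _) => [/DU->|]; last by rewrite -memvE.
  by rewrite /skew_map scaler0 subr0.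
exists a, (D y); split; first exact: aU.
  by rewrite so_skew // D1 polarC polar0l oppr0.
move=> _ /memv_addP[u uU [_ /vlineP[k ->] ->]].
rewrite linearD linearZ /= DU // add0r /skew_map !polarE ay aU // mulr1 add0r.
rewrite so_skew // (DU u uU) [polar (D y) y]polarC Dso [polar y 0]polarC.
by rewrite polar0l oppr0 mulr0 addr0 scale0r subr0.
Qed.

Lemma so_fix1_agrees (Cdiv : cayley_division C) D x y : so_fix1 D ->
  exists d : 'End(C), [/\ derivation d, D x = d x & D y = d y].
Proof.
move=> DC; pose U := (<[one]> + <[x]>)%VS.
have DU1 : {in <[one]>%VS, forall u, D u = 0}.
  by move=> _ /vlineP[k ->]; rewrite linearZ /= (proj2 DC) scaler0.
have [a1 [b1 [a10 b10 E1]]] := so_fix1_peel D _ x DC (memv_line one) DU1.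
(* After removing the skew map [E] that moves [x] as [D] does, what is left
   kills [1] and [x], and is a skew map on the span of [1], [x] and [y]. *)
have [E [Eso Eone] EE] := skew_map_lfun _ _ a10 b10.
have DEC : so_fix1 (D - E).
  split=> [z|]; rewrite !lfunE /= !lfunE /= ?(proj2 DC) ?Eone ?subr0 //.
  by rewrite !polarE Eso (proj1 DC) subr0.
have DEU : {in U, forall u, (D - E) u = 0}.
  by move=> u uU; rewrite !lfunE /= !lfunE /= E1 // EE subrr.
have U1 : one \in U by apply/(subvP (addvSl _ _))/memv_line.
have [a2 [b2 [a20 b20 E2]]] := so_fix1_peel _ _ y DEC U1 DEU.
have V1 : one \in (U + <[y]>)%VS by apply/(subvP (addvSl _ _)).
have dimV : (\dim (U + <[y]>) <= 3)%N.
  have dim_add1 (V : {vspace C}) z : (\dim (V + <[z]>) <= (\dim V).+1)%N.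
    have [le_dim _] := dimv_add_leqif V <[z]>.
    by apply: leq_trans le_dim _; rewrite -addn1 leq_add2l dim_vline leq_b1.
  apply: leq_trans (dim_add1 _ _) _; rewrite ltnS.
  by apply: leq_trans (dim_add1 _ _) _; rewrite ltnS dim_vline leq_b1.
have [d1 der1 dE1] := skew_map_agrees Cdiv _ _ _ V1 dimV a10 b10.
have [d2 der2 dE2] := skew_map_agrees Cdiv _ _ _ V1 dimV a20 b20.
have agree : {in (U + <[y]>)%VS, forall u, D u = (d1 + d2) u}.
  move=> u uV; have := E2 u uV; rewrite !lfunE /= !lfunE /= dE1 // dE2 // EE.
  by move=> <-; rewrite addrC subrK.
exists (d1 + d2); split; first exact: derivationD.
- by apply/agree/(subvP (addvSl _ _))/(subvP (addvSr _ _))/memv_line.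
- by apply/agree/(subvP (addvSr _ _))/memv_line.
Qed.

Lemma local_derivation_so_fix1 D : local_derivation D -> so_fix1 D.
Proof.
move=> Dloc; split=> [x|]; last first.
  by have [d /derivation_so_fix1[_ <-] ->] := Dloc one.
by have [d /derivation_so_fix1[dso _] ->] := Dloc x.
Qed.

Lemma two_local_derivation_so_fix1 (D : C -> C) :
  two_local_derivation D -> exists2 d : 'End(C), so_fix1 d & D =1 d.
Proof.
move=> D2; have Dskew x y : polar (D x) y = - polar x (D y).
  by have [d [/derivation_so_fix1[dso _] -> ->]] := D2 x y; apply: so_skew.
(* Skewness determines [D] on a linear combination, by nondegeneracy. *)
have Dlin : linear D.
  by move=> k x y; apply: polar_ext => z; rewrite !(Dskew, polarE); ring.
have [d dE] := lfun_of_linear D Dlin.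
exists d => //; split=> [x|]; rewrite dE.
  by have [e [/derivation_so_fix1[eso _] -> _]] := D2 x x.
by have [e [/derivation_so_fix1[_ <-] -> _]] := D2 one one.
Qed.

Lemma res_trace0E d (v : subvs_of (trace0 C)) :
  so_fix1 d -> vsval (res_trace0 d v) = d (vsval v).
Proof.
move=> [dso d1]; rewrite /res_trace0 !comp_lfunE !lfunE /= vsprojK //.
by rewrite mem_trace0 /ctrace so_skew // d1 polarC polar0l oppr0.
Qed.

(** * Restriction to the trace zero subspace *)

Lemma trace0P x : reflect (polar x one = 0) (x \in trace0 C).
Proof. by rewrite mem_trace0; apply: eqP. Qed.

Lemma orth_trace0 x :
  (forall v, v \in trace0 C -> polar x v = 0) -> x \in <[one]>%VS.
Proof.
move=> xC0; apply: orth_orth => w /orthP w1; apply/xC0/trace0P.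
exact/w1/memv_line.
Qed.

Lemma trace_one_exists : exists e : C, polar e one = 1.
Proof.
have [|e _ e1] := polar_separate 0%VS one; last by exists e.
by rewrite memv0 cone_neq0.
Qed.

Lemma sub_trace_one x e : polar e one = 1 -> x - polar x one *: e \in trace0 C.
Proof. by move=> e1; apply/trace0P; rewrite !polarE e1 mulr1 subrr. Qed.

Lemma so_linear_comb (k : F) d1 d2 : so d1 -> so d2 -> so (k *: d1 + d2).
Proof.
by move=> s1 s2 x; rewrite add_lfunE scale_lfunE !polarE s1 s2 mulr0 addr0.
Qed.

Lemma so_fix1_lie_subalgebra : lie_subalgebra (@so_fix1 F C).
Proof.
split=> [|k d e [ds d1] [es e1]|d e [ds d1] [es e1]].
- by split=> [x|]; rewrite lfunE // polarC polar0l.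
- split; first exact: so_linear_comb.
  by rewrite add_lfunE scale_lfunE d1 e1 scaler0 addr0.
split=> [x|]; rewrite !lie_bracketE; last first.
  by rewrite d1 e1 (linear0 d) (linear0 e) subr0.
rewrite !polarE (so_skewr d x (e x) ds) (so_skewr e x (d x) es).
by rewrite [polar (e x) _]polarC subrr.
Qed.

Lemma so_trace0_lie_subalgebra : lie_subalgebra (@so_trace0 F C).
Proof.
have skew (d : 'End(subvs_of (trace0 C))) u v :
    so_trace0 d ->
    polar (vsval u) (vsval (d v)) = - polar (vsval (d u)) (vsval v).
  case=> _ ds; have := ds (u + v); rewrite !linearD /= !polarE !ds add0r addr0.
  by move/eqP; rewrite addr_eq0 [polar (vsval v) _]polarC => /eqP.
split=> [|k d e [dt ds] [et es]|d e dS eS].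
- split=> [_|v]; last by rewrite lfunE linear0 polarC polar0l.
  by rewrite /lfun_trace big1 // => i _; rewrite lfunE linear0.
- split=> [c2|v]; first by rewrite lfun_trace_linear dt // et // mulr0 addr0.
  rewrite add_lfunE scale_lfunE linearD linearZ /= !polarE ds es.
  by rewrite mulr0 addr0.
split=> [_|v]; first exact: lfun_trace_bracket.
rewrite !lie_bracketE linearB /= !polarE.
rewrite (skew d v (e v)) // (skew e v (d v)) //.
by rewrite [polar (vsval (e v)) _]polarC subrr.
Qed.

(** In characteristic 2, a skew map [D] with [D(1) = l 1] restricts to a map of
    trace [l] on the trace zero elements: up to the term [l], its trace is the
    sum of the entrywise products of a symmetric and an alternating matrix,
    which vanishes. *)
Lemma lfun_trace_restriction D (f : 'End(subvs_of (trace0 C))) (l : F) :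
  so D -> D one = l *: one -> (forall v, vsval (f v) = D (vsval v)) ->
  2%N \in [pchar F] -> lfun_trace f = l.
Proof.
move=> Dso D1 fD char2; have two0 : 2%:R = 0 :> F := pcharf0 char2.
have [e e1] := trace_one_exists.
pose m := \dim {:subvs_of (trace0 C)}.
set X := vbasis {:subvs_of (trace0 C)}; pose v (i : 'I_m) := vsval X`_i.
(* The vectors [w i] represent the coordinate forms of the basis [v] of the
   trace zero subspace, extended by zero on [e]. *)
pose coordC i z : F^o := coord X i (vsproj (trace0 C) (z - polar z one *: e)).
have coordC_lin i : linear (coordC i).
  move=> k x y; rewrite /coordC -linearP -linearP.
  congr (coord X i (vsproj _ _)).
  by apply: polar_ext => z; rewrite !polarE; ring.
have /fin_all_exists[w wE] i : exists w, forall z, polar w z = coordC i z.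
  exact: polar_functional.
have expand z : z = \sum_i polar (w i) z *: v i + polar z one *: e.
  rewrite -[LHS](subrK (polar z one *: e)); congr (_ + _).
  rewrite -[LHS](vsprojK (sub_trace_one z e e1)).
  rewrite [X in vsval X](coord_vbasis (memvf _)).
  by rewrite linear_sum; apply: eq_bigr => i _; rewrite linearZ /= wE.
have polar_expand x z : polar x z =
    \sum_i polar (w i) z * polar x (v i) + polar z one * polar x e.
  rewrite [in LHS](expand z) polarDr polar_sumr polarZr; congr (_ + _).
  by apply: eq_bigr => i _; rewrite polarZr.
have dual i : v i = \sum_j polar (v i) (v j) *: w j + polar (v i) e *: one.
  apply: polar_ext => z; rewrite polar_expand polarDl polar_suml; congr (_ + _).
    by apply: eq_bigr => j _; rewrite polarZl mulrC.
  by rewrite polarZl [polar one z]polarC mulrC.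
have trE : lfun_trace f = \sum_i polar (w i) (D (v i)).
  apply: eq_bigr => i _; rewrite wE /coordC /v -fD.
  have /trace0P -> := valP (f X`_i).
  by rewrite scale0r subr0 vsvalK.
have Dv i : polar (w i) (D (v i)) =
    \sum_j polar (v i) (v j) * polar (w i) (D (w j))
    + l * (polar (w i) one * polar (v i) e).
  rewrite [in LHS](dual i) linearD linear_sum linearZ /= D1.
  rewrite polarDr polar_sumr !polarE.
  congr (_ + _); last by ring.
  by apply: eq_bigr => j _; rewrite linearZ polarE.
rewrite trE; under eq_bigr do rewrite Dv.
rewrite big_split /= sum_alternating ?add0r; first last.
- move=> i j; rewrite polarC [polar (w i) _]polarC so_skew //; ring.
- by move=> i; rewrite Dso mulr0.
rewrite -mulr_sumr -[RHS]mulr1; congr (_ * _).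
(* [polar e e] vanishes in characteristic 2. *)
have := polar_expand e one; rewrite e1 polarxx -mulr_natr two0 mulr0 mul0r.
by rewrite addr0 => ->; apply: eq_bigr => i _; rewrite [polar e _]polarC.
Qed.

Lemma res_trace0_linear (k : F) d1 d2 :
  res_trace0 (k *: d1 + d2) = k *: res_trace0 d1 + res_trace0 d2.
Proof.
by rewrite /res_trace0 comp_lfunDr -comp_lfunZr comp_lfunDl -comp_lfunZl.
Qed.

Lemma res_trace0_bracket d1 d2 : so_fix1 d1 -> so_fix1 d2 ->
  res_trace0 (lie_bracket d1 d2) = lie_bracket (res_trace0 d1) (res_trace0 d2).
Proof.
move=> d1S d2S; have [_ _ bracketS] := so_fix1_lie_subalgebra.
apply/lfunP => v; apply: val_inj; rewrite /= res_trace0E; last exact: bracketS.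
rewrite !lie_bracketE linearB /=.
by rewrite !res_trace0E.
Qed.

(** An element [d] of [so(C, n)] that vanishes on trace zero elements also
    vanishes at an element [e] of trace 1: [d(e)] is orthogonal to them and to
    [e]. *)
Lemma res_trace0_inj d1 d2 : so_fix1 d1 -> so_fix1 d2 ->
  res_trace0 d1 = res_trace0 d2 -> d1 = d2.
Proof.
move=> d1S d2S eq12; have [e e1] := trace_one_exists.
have eqC0 v : v \in trace0 C -> d1 v = d2 v.
  by move=> /vsprojK <-; rewrite -!res_trace0E // eq12.
have decomp z : exists v k, v \in trace0 C /\ z = v + k *: e.
  exists (z - polar z one *: e), (polar z one).
  by rewrite subrK sub_trace_one.
have eqe : d1 e = d2 e.
  apply: polar_ext => z; have [v [k [vC0 ->]]] := decomp z.
  have [[d1so _] [d2so _]] := (d1S, d2S).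
  rewrite !polarDr !polarZr (so_skew d1 e v d1so) (so_skew d2 e v d2so).
  rewrite (eqC0 _ vC0) [polar (d1 e) e]polarC [polar (d2 e) e]polarC.
  by rewrite d1so d2so.
apply/lfunP => z; have [v [k [vC0 ->]]] := decomp z.
by rewrite !linearD !linearZ /= eqe (eqC0 _ vC0).
Qed.

Lemma res_trace0_so d : so_fix1 d -> so_trace0 (res_trace0 d).
Proof.
move=> dS; split=> [c2|v]; last by rewrite res_trace0E //; apply: (proj1 dS).
apply: (lfun_trace_restriction d _ 0) => //; first exact: (proj1 dS).
  by rewrite scale0r (proj2 dS).
by move=> v; apply: res_trace0E.
Qed.

(** A map [f] in [so(C_0, n)] extends to [C = C_0 + F e], with [t(e) = 1], by
    sending [e] to the vector [w] that skewness prescribes. The value at 1 of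
    the extension is a scalar, which is zero because of the trace condition in
    characteristic 2, and by skewness otherwise. *)
Lemma res_trace0_surj (f : 'End(subvs_of (trace0 C))) : so_trace0 f ->
  exists2 d : 'End(C), so_fix1 d & res_trace0 d = f.
Proof.
move=> [f_trace fso]; have [e e1] := trace_one_exists.
pose h z := vsval (f (vsproj (trace0 C) (z - polar z one *: e))).
have h_lin : linear h.
  move=> k x y; rewrite /h -!linearP; congr (vsval (f (vsproj _ _))).
  by apply: polar_ext => z; rewrite !polarE; ring.
have phi_lin : linear (fun z => - polar e (h z) : F^o).
  by move=> k x y; rewrite h_lin !polarE opprD -mulrN.
have [w wE] := polar_functional _ phi_lin.
have D_lin : linear (fun z => h z + polar z one *: w).
  by move=> k x y; rewrite h_lin; apply: polar_ext => z; rewrite !polarE; ring.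
have [D DE] := lfun_of_linear _ D_lin.
have Dso : so D.
  move=> z; rewrite DE polarDr polarZr [polar z w]polarC wE.
  have := fso (vsproj (trace0 C) (z - polar z one *: e)).
  rewrite -/(h z) (vsprojK (sub_trace_one z e e1)) !polarE => <-; ring.
have Df v : vsval (f v) = D (vsval v).
  have /trace0P v0 := valP v.
  by rewrite DE /h v0 !scale0r subr0 addr0 vsvalK.
have /vlineP[l D1] : D one \in <[one]>%VS.
  apply: orth_trace0 => v vC0; rewrite so_skew // polarC -(vsprojK vC0) -Df.
  have /trace0P -> := valP (f (vsproj (trace0 C) v)).
  by rewrite oppr0.
have l0 : l = 0.
  have := Dso one; rewrite D1 polarE polarxx cnorm1 => /eqP.
  rewrite mulf_eq0 => /orP[/eqP//|/eqP two0].
  have c2 : 2%N \in [pchar F] by rewrite inE /= two0.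
  by rewrite -(lfun_trace_restriction D f l) // f_trace.
have DS : so_fix1 D by split=> //; rewrite D1 l0 scale0r.
exists D => //; apply/lfunP => v; apply: val_inj.
by rewrite /= res_trace0E // Df.
Qed.

End CayleyAlgebra.

Theorem theorem4p9 (F : fieldType) (C : cayleyAlg F)
    (Cdiv : cayley_division C) :
  [/\ (* local derivations are 2-local derivations *)
      forall D : 'End(C), local_derivation D -> two_local_derivation D,
      (* the 2-local derivations are the d in so(C, n) with d(1) = 0 *)
      forall D : C -> C,
        two_local_derivation D <-> exists2 d : 'End(C), so_fix1 d & D =1 d,
      (* res_trace0 is the restriction map on that space *)
      forall (d : 'End(C)) (v : subvs_of (trace0 C)),
        so_fix1 d -> vsval (res_trace0 d v) = d (vsval v)
    & (* and it is a Lie algebra isomorphism onto so(C_0, n) *)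
      lie_isomorphism (@so_fix1 F C) (@so_trace0 F C) (@res_trace0 F C)].
Proof.
split.
- by move=> D /local_derivation_so_fix1 DS x y; apply: so_fix1_agrees.
- move=> D; split; first exact: two_local_derivation_so_fix1.
  by case=> d dS Dd x y; rewrite !Dd; apply: so_fix1_agrees.
- exact: res_trace0E.
split.
- by split; [apply: so_fix1_lie_subalgebra | apply: so_trace0_lie_subalgebra].
- by move=> k d e _ _; apply: res_trace0_linear.
- exact: res_trace0_bracket.
- exact: res_trace0_inj.
- by split; [apply: res_trace0_so | apply: res_trace0_surj].
Qed.
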